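(* Let $K$ be a field, $q\ge 2$ an integer, $n_1,\ldots,n_q$ positive integers and $n=n_1+\cdots+n_q$. Let $\mathcal{A}$ be a D$_q$ subalgebra of $\mathrm{M}_n(K)$ of type $(n_1,n_2,\ldots,n_q)$ with max-comm db's. Then $\mathcal{A}$ is a maximal D$_q$ subalgebra of $\mathrm{M}_n(K)$.
   Context: All algebras are associative and unital over the field $K$; a subalgebra of $\mathrm{M}_n(K)$ is a (unital) $K$-subalgebra. $[x,y]=xy-yx$. An algebra is D$_q$ if it satisfies the identity $[x_1,y_1][x_2,y_2]\cdots[x_q,y_q]=0$. Convention: whenever a D$_q$ subalgebra of $\mathrm{M}_n(K)$ is considered, it is assumed that $q\ge 2$ and that it is not D$_{q-1}$. A maximal D$_q$ subalgebra of $\mathrm{M}_n(K)$ is a D$_q$ subalgebra that is maximal with respect to inclusion among D$_q$ subalgebras of $\mathrm{M}_n(K)$. For positive integers $n_1,\ldots,n_q$ ($q\ge 2$) with $n_1+\cdots+n_q=n$, view matrices in $\mathrm{M}_n(K)$ as $q\times q$ block matrices whose $(i,j)$ block has size $n_i\times n_j$. A subalgebra $\mathcal{A}$ of $\mathrm{M}_n(K)$ is of type $(n_1,\ldots,n_q)$ if there are subalgebras $\mathcal{A}_{ii}$ of $\mathrm{M}_{n_i}(K)$, $i=1,\ldots,q$ (its diagonal blocks), such that $\mathcal{A}$ consists of exactly all block matrices whose $(i,i)$ block lies in $\mathcal{A}_{ii}$ (independently for each $i$), whose $(i,j)$ block is an arbitrary element of $\mathrm{M}_{n_i\times n_j}(K)$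 for $i<j$, and whose $(i,j)$ block is zero for $i>j$. It is a D$_q$ subalgebra of $\mathrm{M}_n(K)$ of type $(n_1,\ldots,n_q)$ with max-comm db's if, moreover, every $\mathcal{A}_{ii}$ is a maximal commutative subalgebra of $\mathrm{M}_{n_i}(K)$. *)

(* Defs.v *)
From HB Require Import structures.
From mathcomp Require Import all_boot all_order all_algebra.

Set Implicit Arguments.
Unset Strict Implicit.
Unset Printing Implicit Defensive.

Import GRing.Theory.

Local Open Scope ring_scope.

Definition subalgebra (K : fieldType) (n : nat) (A : {vspace 'M[K]_n}) : Prop :=
  1%:M \in A /\ {in A &, forall x y, x *m y \in A}.

Definition commutative_subalgebra (K : fieldType) (n : nat)
    (A : {vspace 'M[K]_n}) : Prop :=
  subalgebra A /\ {in A &, forall x y, x *m y = y *m x}.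

Definition max_commutative_subalgebra (K : fieldType) (n : nat)
    (A : {vspace 'M[K]_n}) : Prop :=
  commutative_subalgebra A /\
  forall B : {vspace 'M[K]_n},
    commutative_subalgebra B -> (A <= B)%VS -> B = A.

Definition commutator (K : fieldType) (n : nat) (x y : 'M[K]_n) : 'M[K]_n :=
  x *m y - y *m x.

Definition Dq_identity (K : fieldType) (n q : nat)
    (A : {vspace 'M[K]_n}) : Prop :=
  forall x y : 'I_q -> 'M[K]_n,
    (forall i, x i \in A) -> (forall i, y i \in A) ->
    \prod_(i < q) commutator (x i) (y i) = 0.

(* By convention a D_q subalgebra has q >= 2 and is not D_(q-1). *)
Definition Dq_subalgebra (K : fieldType) (n q : nat)
    (A : {vspace 'M[K]_n}) : Prop :=
  [/\ (2 <= q)%N, subalgebra A, Dq_identity q A & ~ Dq_identity q.-1 A].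

Definition max_Dq_subalgebra (K : fieldType) (n q : nat)
    (A : {vspace 'M[K]_n}) : Prop :=
  Dq_subalgebra q A /\
  forall B : {vspace 'M[K]_n},
    Dq_subalgebra q B -> (A <= B)%VS -> B = A.

(* [D i] is the i-th diagonal block of [A]. *)
Definition subalgebra_of_type (K : fieldType) (q : nat) (n_ : 'I_q -> nat)
    (A : {vspace 'M[K]_(\sum_(i < q) n_ i)%N})
    (D : forall i : 'I_q, {vspace 'M[K]_(n_ i)}) : Prop :=
  [/\ subalgebra A,
      forall i, subalgebra (D i)
    & forall a : 'M[K]_(\sum_(i < q) n_ i)%N,
        a \in A <->
        (forall i, submxblock a i i \in D i) /\
        (forall i j : 'I_q, (j < i)%N -> submxblock a i j = 0)].

(* The D_q identity and the failure of D_(q-1) are not required here: both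
   follow from the block form when all block sizes are positive. *)
Definition of_type_max_comm_db (K : fieldType) (q : nat) (n_ : 'I_q -> nat)
    (A : {vspace 'M[K]_(\sum_(i < q) n_ i)%N}) : Prop :=
  exists D : forall i : 'I_q, {vspace 'M[K]_(n_ i)},
    subalgebra_of_type A D /\ forall i, max_commutative_subalgebra (D i).

(* Main.v *)
(** Write e_k for the identity of the k-th diagonal block.  Each matrix unit
    E_st with s in block k and t in a later block is the commutator [e_k, E_st],
    so E_ps and E_tr, with p in the first and r in the last block, are products
    of commutators, one for each block boundary crossed.  In particular E_pr is
    a nonzero product of q-1 commutators.  If c is a commutator in a D_q algebra
    containing the e_k and the strictly block upper triangular matrices, and c
    has a nonzero entry at (s, t), t not in a later block than s, then
    E_ps c E_tr = c_st E_pr is a nonzero product of at least q commutators, a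
    contradiction.  Thus c is
    strictly block upper triangular; taking c = [e_i, b] makes b block upper
    triangular, and taking c = [x e_i, y e_i] makes the (i, i) blocks commute,
    so they form the given maximal commutative algebra. *)

Require Import Defs.
From HB Require Import structures.
From mathcomp Require Import all_boot all_order all_algebra zify.

Set Implicit Arguments.
Unset Strict Implicit.
Unset Printing Implicit Defensive.

Import GRing.Theory.

Local Open Scope ring_scope.

(** Lists of pairs, rather than families over ['I_q], let products of different lengths be
    concatenated. *)
Definition commutator_prod (K : fieldType) (n : nat)
    (w : seq ('M[K]_n * 'M[K]_n)) : 'M[K]_n :=
  \prod_(u <- w) commutator u.1 u.2.

Definition pairs_in (K : fieldType) (n : nat) (B : {vspace 'M[K]_n})
    (w : seq ('M[K]_n * 'M[K]_n)) : bool :=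
  all (fun u => (u.1 \in B) && (u.2 \in B)) w.

Lemma commutator_prod_eq0 (K : fieldType) (n q : nat) (B : {vspace 'M[K]_n})
    (w : seq ('M[K]_n * 'M[K]_n)) :
  Dq_identity q B -> pairs_in B w -> (q <= size w)%N -> commutator_prod w = 0.
Proof.
move=> hB /allP hw le_q; rewrite /commutator_prod -(cat_take_drop q w) big_cat /=.
have szq : size (take q w) = q by rewrite size_takel.
suff -> : \prod_(u <- take q w) commutator u.1 u.2 = 0 by rewrite mul0r.
rewrite (big_nth (0, 0)) szq big_mkord.
have hin (i : 'I_q) : nth (0, 0) (take q w) i \in w.
  by apply: (@mem_take q); rewrite mem_nth // szq.
by apply: (hB (fun i => (nth (0, 0) (take q w) i).1)
              (fun i => (nth (0, 0) (take q w) i).2)) => i;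
   case/andP: (hw _ (hin i)).
Qed.

(** * Block idempotents and blocks of products *)

Section BlockMatrices.

Import tagnat.

Variables (K : fieldType) (q : nat) (n_ : 'I_q -> nat).

Local Notation sn := (\sum_(i < q) n_ i)%N.

Implicit Types (B : {vspace 'M[K]_sn}) (s t : 'I_sn).

Definition block_id (i : 'I_q) : 'M[K]_sn :=
  diag_mx (\row_t (sig1 t == i)%:R).

Lemma mul_block_idl i (x : 'M[K]_sn) s t :
  (block_id i *m x) s t = (sig1 s == i)%:R * x s t.
Proof. by rewrite mul_diag_mx !mxE. Qed.

Lemma mul_block_idr i (x : 'M[K]_sn) s t :
  (x *m block_id i) s t = x s t * (sig1 t == i)%:R.
Proof. by rewrite mul_mx_diag !mxE. Qed.

Lemma block_idK i : block_id i *m block_id i = block_id i.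
Proof.
apply/matrixP=> s t; rewrite mul_block_idl !mxE.
by case: (s =P t) => [->|_]; rewrite ?mulr0n ?mulr0 // -natrM mulnb andbb.
Qed.

Lemma submxblock_block_id i j : submxblock (block_id i) j j = (j == i)%:R%:M.
Proof.
apply/matrixP=> k l; rewrite !mxE Rank1K (inj_eq rank_inj).
by rewrite -tag_eqE /tag_eq eqxx /= tagged_asE.
Qed.

Lemma submxblock_block_id_neq i j k :
  j != k -> submxblock (block_id i) j k = 0.
Proof.
move=> jk; apply/matrixP=> a b; rewrite !mxE.
case: (Rank j a =P Rank k b) => [ab|_]; last by rewrite mulr0n.
by case/eqP: jk; rewrite -(Rank1K (p_ := n_) a) ab Rank1K.
Qed.

Lemma submxblock_mul (x y : 'M[K]_sn) i j :
  submxblock (x *m y) i j = \sum_k submxblock x i k *m submxblock y k j.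
Proof.
by rewrite -{1}(submxblockK x) -{1}(submxblockK y) mul_mxblock mxblockK.
Qed.

(** The factor [block_id i] kills every term [k != i] of the block product, even when [x] and [y]
    are not block triangular. *)
Lemma submxblock_mul_block_id (x y : 'M[K]_sn) i :
  submxblock (x *m block_id i *m y) i i = submxblock x i i *m submxblock y i i.
Proof.
rewrite submxblock_mul (bigD1 i) //= [X in _ + X]big1 ?addr0 => [|k ki].
  congr (_ *m _); apply/matrixP=> a b.
  by rewrite ![submxblock _ _ _ _ _]mxE mul_block_idr Rank1K eqxx mulr1.
suff -> : submxblock (x *m block_id i) i k = 0 by rewrite mul0mx.
apply/matrixP=> a b; rewrite ![submxblock _ _ _ _ _]mxE mul_block_idr Rank1K.
by rewrite (negPf ki) mulr0 mxE.
Qed.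

Lemma submxblock_eq0P (x : 'M[K]_sn) i j :
  submxblock x i j = 0 <->
  (forall s t, sig1 s = i -> sig1 t = j -> x s t = 0).
Proof.
split=> [x0 s t si tj|x0]; last first.
  by apply/matrixP=> a b; rewrite !mxE x0 // Rank1K.
case: _ / si x0; case: _ / tj => /matrixP/(_ (sig2 s) (sig2 t)).
by rewrite !mxE !sig2K.
Qed.

Lemma commutator_delta s t :
  (sig1 s < sig1 t)%N ->
  commutator (block_id (sig1 s)) (delta_mx s t) = delta_mx s t.
Proof.
move=> st; apply/matrixP=> u v; rewrite [LHS]mxE [X in _ + X]mxE.
rewrite mul_block_idl mul_block_idr !mxE.
case: (u =P s) => [->|_]; last by rewrite mulr0 mul0r subr0.
case: (v =P t) => [->|_]; last by rewrite mulr0 mul0r subr0.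
by rewrite eqxx mul1r -val_eqE /= gtn_eqF // mulr0 subr0.
Qed.

(** * Chains of commutators reaching the first and last blocks *)

Section Chains.

Variable B : {vspace 'M[K]_sn}.
Hypothesis n_gt0 : forall i, (0 < n_ i)%N.
Hypothesis block_id_in : forall i, block_id i \in B.
Hypothesis delta_in : forall s t, (sig1 s < sig1 t)%N -> delta_mx s t \in B.

Lemma ex_block_index (k : nat) : (k < q)%N -> exists s, sig1 s = k :> nat.
Proof.
move=> kq; exists (Rank (Ordinal kq) (Ordinal (n_gt0 (Ordinal kq)))).
by rewrite Rank1K.
Qed.

(* The product of the chain is E_ps, except that the empty chain (s in the
   first block) gives the identity: only its row p is prescribed. *)
Lemma left_chain s : exists p w,
  [/\ pairs_in B w, size w = sig1 s
    & forall c : 'M[K]_sn, row p (commutator_prod w *m c) = row s c].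
Proof.
move: {2}(val (sig1 s)) (erefl (val (sig1 s))) => k.
elim: k s => [|k IH] s sk.
  by exists s, [::]; split=> // c; rewrite /commutator_prod big_nil mul1mx.
have [s' s'k] : exists s', sig1 s' = k :> nat.
  by apply: ex_block_index; move: (ltn_ord (sig1 s)) sk => /=; lia.
have lt_s's : (sig1 s' < sig1 s)%N by rewrite s'k sk.
have [p [w [win wsz wrow]]] := IH s' s'k.
exists p, (rcons w (block_id (sig1 s'), delta_mx s' s)); split.
- by rewrite /pairs_in all_rcons /= block_id_in delta_in.
- by rewrite size_rcons wsz s'k sk.
move=> c; rewrite /commutator_prod big_rcons /= commutator_delta //.
rewrite -mulmxA wrow rowE mulmxA mul_delta_mx.
by rewrite -rowE.
Qed.

(** Mirror image of the left chain, by induction on the distance from the block of [t] to the last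
    block, of index [q.-1]. *)
Lemma right_chain t : exists p w,
  [/\ pairs_in B w, size w = (q.-1 - sig1 t)%N
    & forall c : 'M[K]_sn, col p (c *m commutator_prod w) = col t c].
Proof.
move: {2}(q.-1 - sig1 t)%N (erefl (q.-1 - sig1 t)%N) => k.
elim: k t => [|k IH] t tk.
  by exists t, [::]; split=> // c; rewrite /commutator_prod big_nil mulmx1.
have [t' t'k] : exists t', sig1 t' = (sig1 t).+1 :> nat.
  by apply: ex_block_index; move: tk => /=; lia.
have lt_tt' : (sig1 t < sig1 t')%N by rewrite t'k.
have t'k' : (q.-1 - sig1 t')%N = k by rewrite t'k subnS tk.
have [p [w [win wsz wcol]]] := IH t' t'k'.
exists p, ((block_id (sig1 t), delta_mx t t') :: w); split.
- by rewrite /pairs_in /= block_id_in delta_in.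
- by rewrite /= wsz t'k' tk.
move=> c; rewrite /commutator_prod big_cons /= commutator_delta //.
by rewrite mulmxA wcol colE -mulmxA mul_delta_mx -colE.
Qed.

Lemma commutator_strictly_upper : Dq_identity q B ->
  {in B &, forall x y s t, (sig1 t <= sig1 s)%N -> commutator x y s t = 0}.
Proof.
move=> hB x y xB yB s t ts.
have [p [w [win wsz wrow]]] := left_chain s.
have [r [v [vin vsz vcol]]] := right_chain t.
have wv0 : commutator_prod w *m (commutator x y *m commutator_prod v) = 0.
  suff: commutator_prod (w ++ (x, y) :: v) = 0.
    by rewrite /commutator_prod big_cat big_cons.
  apply: (commutator_prod_eq0 hB).
    by rewrite /pairs_in all_cat /= xB yB !andbT; apply/andP.
  (* There are [sig1 s + 1 + (q.-1 - sig1 t)] factors, at least [q] because [sig1 t <= sig1 s]. *)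
  by rewrite size_cat /= wsz vsz; move: (ltn_ord (sig1 t)) ts; lia.
transitivity (col r (row p 0) 0 0 : K); last by rewrite !mxE.
rewrite -wv0 wrow; have /matrixP/(_ s 0) := vcol (commutator x y).
by rewrite !mxE => ->.
Qed.

End Chains.

(** Each factor raises the block index by at least one, so a nonzero entry needs
    [sig1 s + m <= sig1 t]; for [m = q] none is left. *)
Lemma prod_strictly_upper m (f : 'I_m -> 'M[K]_sn) s t :
  (forall k u v, (sig1 v <= sig1 u)%N -> f k u v = 0) ->
  (sig1 t < sig1 s + m)%N -> (\prod_(k < m) f k) s t = 0.
Proof.
elim: m f s => [|m IH] f s f0 st.
  rewrite big_ord0 mxE; case: eqP => // e.
  by rewrite e addn0 ltnn in st.
rewrite big_ord_recl mxE big1 // => u _.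
have [us|su] := leqP (sig1 u) (sig1 s); first by rewrite f0 ?mul0r.
rewrite IH ?mulr0 // => [k|]; first exact: f0.
by apply: leq_trans st _; rewrite addnS -addSn leq_add2r.
Qed.

(** * Algebras of block type *)

Section SubalgebraOfType.

Variables (A : {vspace 'M[K]_sn}) (D : forall i : 'I_q, {vspace 'M[K]_(n_ i)}).
Hypothesis AD : subalgebra_of_type A D.

Lemma block_id_mem i : block_id i \in A.
Proof.
case: AD => _ hD ->; split=> [j|j k kj]; last first.
  by rewrite submxblock_block_id_neq // -val_eqE /= gtn_eqF.
rewrite submxblock_block_id; case: eqP => _; first by case: (hD j).
by rewrite (_ : _%:M = 0) ?mem0v //; apply/matrixP=> a b; rewrite !mxE mul0rn.
Qed.

Lemma delta_mem s t : (sig1 s < sig1 t)%N -> delta_mx s t \in A.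
Proof.
have d0 (i j : 'I_q) : (sig1 s < sig1 t)%N -> (j <= i)%N ->
    submxblock (delta_mx s t) i j = 0 :> 'M[K]_(_, _).
  move=> st ji; apply/submxblock_eq0P => u v ui vj; rewrite mxE.
  case: (u =P s) => // us; case: (v =P t) => // vt.
  by move: st; rewrite -us -vt ui vj ltnNge ji.
case: AD => _ _ -> st; split=> [i|i j ji]; last by rewrite d0 // ltnW.
by rewrite d0 // mem0v.
Qed.

(** For [k != i], one of the blocks (i, k) of [x] and (k, i) of [y] lies below the diagonal. *)
Lemma submxblock_mul_diag x y i : x \in A -> y \in A ->
  submxblock (x *m y) i i = submxblock x i i *m submxblock y i i.
Proof.
case: AD => _ _ memA /memA[_ x0] /memA[_ y0].
rewrite submxblock_mul (bigD1 i) //= [X in _ + X]big1 ?addr0 // => k.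
rewrite -val_eqE neq_ltn => /orP[ki|ik]; first by rewrite x0 // mul0mx.
by rewrite y0 // mulmx0.
Qed.

(** Taking a diagonal block is multiplicative on [A], so it sends a commutator to a commutator in
    some [D i], which is zero. *)
Lemma commutator_strictly_upper_comm :
  (forall i, {in D i &, forall x y, x *m y = y *m x}) ->
  {in A &, forall x y s t, (sig1 t <= sig1 s)%N -> commutator x y s t = 0}.
Proof.
move=> commD x y xA yA s t ts.
have [[_ mulA] _ memA] := AD.
have cA : commutator x y \in A by rewrite rpredB // mulA.
suff: submxblock (commutator x y) (sig1 s) (sig1 t) = 0.
  by move=> /submxblock_eq0P; apply.
have [_ c0] := (memA _).1 cA.
move: ts; rewrite leq_eqVlt => /orP[/eqP/val_inj->|]; last exact: c0.
rewrite submxblockB !submxblock_mul_diag //.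
have [[xD _] [yD _]] := ((memA _).1 xA, (memA _).1 yA).
by rewrite (commD _ _ _ (xD (sig1 s)) (yD _)) subrr.
Qed.

End SubalgebraOfType.

End BlockMatrices.

Theorem theorem4p3 (K : fieldType) (q : nat) (hq : (2 <= q)%N)
    (n_ : 'I_q -> nat) (n_gt0 : forall i, (0 < n_ i)%N)
    (A : {vspace 'M[K]_(\sum_(i < q) n_ i)%N}) :
  of_type_max_comm_db A -> max_Dq_subalgebra q A.
Proof.
case=> D [AD maxD]; have [subA subD memA] := AD.
have commD i : {in D i &, forall x y, x *m y = y *m x} by case: (maxD i) => [[]].
split.
  split=> //.
    move=> x y xA yA; apply/matrixP=> s t; rewrite mxE.
    apply: prod_strictly_upper => [k u v|]; last first.
      by rewrite (leq_trans (ltn_ord _)) // leq_addl.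
    by apply: (commutator_strictly_upper_comm AD commD).
  (* A chain from the first block to the last has [q.-1] factors, and its product has a row equal to
     row [s] of the identity. *)
  move=> hA.
  have [s sq] : exists s : 'I_(\sum_i n_ i), tagnat.sig1 s = q.-1 :> nat.
    by apply: (ex_block_index n_gt0); lia.
  have [p [w [win wsz wrow]]] :=
    left_chain n_gt0 (block_id_mem AD) (delta_mem AD) s.
  have := wrow 1%:M; rewrite (commutator_prod_eq0 hA win) ?wsz ?sq // mul0mx.
  move=> /rowP/(_ s)/esym/eqP; rewrite !mxE eqxx.
  by rewrite (negPf (oner_neq0 K)).
move=> B [_ [oneB mulB] hB _] AB; have subAB := subvP AB.
have eB i : block_id K n_ i \in B by apply/subAB/(block_id_mem AD).
have Bc : {in B &, forall x y s t, (tagnat.sig1 t <= tagnat.sig1 s)%N ->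
    commutator x y s t = 0}.
  apply: commutator_strictly_upper => // s t st.
  exact/subAB/(delta_mem AD).
have diagB i : {in B &, forall x y,
    submxblock x i i *m submxblock y i i = submxblock y i i *m submxblock x i i}.
  move=> x y xB yB.
  have c0 : submxblock
      (commutator (x *m block_id K n_ i) (y *m block_id K n_ i)) i i = 0.
    by apply/submxblock_eq0P => s t si ti; rewrite Bc ?mulB // si ti.
  have sub_idr (z : 'M[K]_(\sum_i n_ i)) :
      submxblock (z *m block_id K n_ i) i i = submxblock z i i.
    (* Splitting the idempotent as its own square gives the form x e_i y. *)
    rewrite -block_idK mulmxA submxblock_mul_block_id.
    by rewrite submxblock_block_id eqxx mulmx1.
  move: c0; rewrite submxblockB !(mulmxA (_ *m block_id K n_ i)).
  by rewrite !sub_idr !submxblock_mul_block_id => /eqP; rewrite subr_eq0 => /eqP.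
apply/eqP; rewrite eqEsubv AB andbT; apply/subvP => b bB.
apply/memA; split=> [i|i j ji]; last first.
  apply/submxblock_eq0P => s t si tj.
  (* In row block [i] and column block [j], distinct from [i], the commutator [e_i, b] agrees with
     [b]. *)
  have := @Bc _ _ (eB i) bB s t; rewrite si tj => /(_ (ltnW ji)).
  rewrite mxE [X in _ + X]mxE mul_block_idl mul_block_idr si tj eqxx mul1r.
  by rewrite -val_eqE /= ltn_eqF // mulr0 subr0.
(* The (i, i) blocks of [B] form a commutative subalgebra containing [D i], so maximality forces
   equality. *)
pose E := (linfun (mxsub (tagnat.Rank i) (tagnat.Rank i)) @: B)%VS.
have memE x : x \in B -> submxblock x i i \in E.
  by move=> xB; apply/memv_imgP; exists x; rewrite // lfunE.
have inE : {in E, forall d, exists2 x, x \in B & d = submxblock x i i}.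
  by move=> d /memv_imgP[x xB ->]; exists x; rewrite // lfunE.
suff <- : E = D i by exact: memE.
have [_] := maxD i; apply; last first.
  apply/subvP => d dD.
  (* This has [d] as block (i, i) and zero elsewhere; [conform_mx] only casts [d] to the dependent
     type, and its default 0 never occurs. *)
  pose a := \mxblock_(k, l)
    (if (k == i) && (l == i) then conform_mx 0 d else 0 : 'M[K]_(n_ k, n_ l)).
  have -> : d = submxblock a i i by rewrite mxblockK eqxx conform_mx_id.
  apply/memE/subAB/memA; split=> [k|k l lk]; rewrite mxblockK ?andbb.
    by case: eqP => [->|_]; rewrite ?conform_mx_id ?mem0v.
  by case: andP => // -[/eqP ki /eqP li]; rewrite ki li ltnn in lk.
split; [split|].
- by rewrite -[1%:M](_ : submxblock (block_id K n_ i) i i = _) ?memE //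
    submxblock_block_id eqxx.
(* The product of two (i, i) blocks is the (i, i) block of x e_i y, which lies in [B]. *)
- move=> _ _ /inE[x xB ->] /inE[y yB ->].
  by rewrite -submxblock_mul_block_id memE // !mulB.
- by move=> _ _ /inE[x xB ->] /inE[y yB ->]; apply: diagB.
Qed.
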